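(* For all positive integers $n\equiv 0,2\pmod 6$ and $m\equiv 4\pmod{12}$, there exists a $2$-D $(n\times m,3,1)$-OOC with exactly $J(n\times m,3,1)$ codewords (hence an optimal one).
   Context: A two-dimensional $(n\times m,k,\lambda)$ optical orthogonal code ($2$-D $(n\times m,k,\lambda)$-OOC) is a family $\mathcal C$ of $n\times m$ $(0,1)$-matrices of Hamming weight $k$, with rows indexed by $\{0,\dots,n-1\}$ and columns by $Z_m$, such that (1) for each $A=(a_{ij})\in\mathcal C$ and each integer $r\not\equiv 0\pmod m$, $\sum_{i}\sum_{j}a_{ij}a_{i,j+r}\le\lambda$; and (2) for each $A=(a_{ij}),B=(b_{ij})\in\mathcal C$ with $A\ne B$ and each integer $r$, $\sum_i\sum_j a_{ij}b_{i,j+r}\le\lambda$ (column indices mod $m$). The size is the number of codewords; it is optimal if its size is the maximum possible, $\Phi(n\times m,k,\lambda)$. It is known that $\Phi(u\times v,k,\lambda)\le J(u\times v,k,\lambda)$ where $J(u\times v,k,\lambda)=\lfloor\frac{u}{k}\lfloor\frac{uv-1}{k-1}\lfloor\frac{uv-2}{k-2}\lfloor\cdots\lfloor\frac{uv-\lambda}{k-\lambda}\rfloor\cdots\rfloor\rfloor\rfloor\rfloor$; in particular $J(u\times v,3,1)=\lfloor\frac{u}{3}\lfloor\frac{uv-1}{2}\rfloor\rfloor$. *)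

(* Defs.v *)
From mathcomp Require Import all_boot all_order all_algebra.

Set Implicit Arguments.
Unset Strict Implicit.
Unset Printing Implicit Defensive.

Import Order.TTheory GRing.Theory Num.Theory.

Lemma cshift_subproof m (r : int) (j : 'I_m) : `|((j%:Z + r)%R %% m)%Z|%N < m.
Proof.
have m_gt0 : (0 < m%:Z)%R by rewrite ltz_nat (leq_ltn_trans (leq0n j)).
by rewrite -ltz_nat gez0_abs ?modz_ge0 ?ltz_pmod ?gt_eqF.
Qed.

(* The column index j + r reduced mod m. 'I_m is used rather than 'Z_m so that
   the width is m for every m (both 'Z_0 and 'Z_1 have two elements). *)
Definition cshift m (r : int) (j : 'I_m) : 'I_m := Ordinal (cshift_subproof r j).

Definition hamming_weight n m (A : 'M[bool]_(n, m)) : nat :=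
  \sum_(i < n) \sum_(j < m) A i j.

Definition correlation n m (A B : 'M[bool]_(n, m)) (r : int) : nat :=
  \sum_(i < n) \sum_(j < m) A i j * B i (cshift r j).

Definition is_OOC n m k lambda (C : {set 'M[bool]_(n, m)}) : Prop :=
  [/\ forall A, A \in C -> hamming_weight A = k,
      forall A (r : int), A \in C -> (r != 0 %[mod m])%Z ->
        correlation A A r <= lambda
    & forall A B (r : int), A \in C -> B \in C -> A <> B ->
        correlation A B r <= lambda].

Definition optimal_OOC n m k lambda (C : {set 'M[bool]_(n, m)}) : Prop :=
  is_OOC k lambda C /\
  forall C' : {set 'M[bool]_(n, m)}, is_OOC k lambda C' -> #|C'| <= #|C|.

(* floor (u/k * floor ((uv-1)/(k-1) * ... floor ((uv-lambda)/(k-lambda)))),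
   the innermost floor being multiplied by 1; meaningful for lambda < k and
   lambda <= uv, where no subtraction is truncated and no divisor is 0. *)
Definition johnson_bound u v k lambda : nat :=
  (u * foldr (fun i x => ((u * v - i) * x) %/ (k - i)) 1 (iota 1 lambda)) %/ k.

Lemma johnson_bound31 u v : johnson_bound u v 3 1 = (u * ((u * v - 1) %/ 2)) %/ 3.
Proof. by rewrite /johnson_bound /= muln1. Qed.

(* Main.v *)
Require Import Defs.
From mathcomp Require Import all_boot all_order all_algebra zify.

Set Implicit Arguments.
Unset Strict Implicit.
Unset Printing Implicit Defensive.

Import Order.TTheory GRing.Theory Num.Theory.

(* Write m = 2M and n = 2h, so that h is 0 or 1 mod 3.  Up to cyclic shift, a
   code of size J = n (nm - 2) / 6 is a list of J triples of points (row, column)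
   which realises every difference (p, q, d) between two rows except the
   differences 0 and M of a row with itself; there are exactly 6J of those, so by
   counting it suffices to realise each of them at least once.

   Group the rows into h pairs.  Two rows of one pair are handled by an explicit
   starter.  The rows of different pairs form the graph K_h[2], and "K_h[w]
   decomposes" means that its rows admit triples realising all m differences on
   every edge.  Triples on three fixed rows cannot do this alone (Z_m has no
   orthomorphism), but they can realise one parity class of differences on one
   edge and an interval of length M on the other two, through x, x -> 2x or
   x, -1-x -> -1-2x.  Fitting such halves together decomposes K_4, K_6 and
   K_3[2], and blow-ups, Bose's and Skolem's triple systems give K_h[2]. *)

(** * Triples of points and the differences they realise *)

(** Columns stay unreduced integers; congruence modulo [m] enters [covers] as an explicit multiple,
    so that the identities to check are linear. *)
Definition block (V : Type) := ((V * int) * (V * int) * (V * int))%type.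

Definition block_map (V V' : Type) (f : V -> V') (b : block V) : block V' :=
  let: ((p, u), (q, v), (r, w)) := b in ((f p, u), (f q, v), (f r, w)).

Definition block_diffs (V : Type) (b : block V) : seq (V * V * int) :=
  let: ((p, u), (q, v), (r, w)) := b in
  [:: (p, q, (v - u)%R); (p, r, (w - u)%R); (q, r, (w - v)%R);
      (q, p, (u - v)%R); (r, p, (u - w)%R); (r, q, (v - w)%R)].

Definition covers (V : eqType) (m : nat) (B : seq (block V)) (p q : V) (d : int) :=
  exists2 b, b \in B & exists k : int, (p, q, (d + k * m%:Z)%R) \in block_diffs b.

Section Covers.
Variables (V V' : eqType) (m : nat).
Implicit Types (p q : V).

Lemma covers_sym (B : seq (block V)) p q d : covers m B p q (- d)%R -> covers m B q p d.
Proof.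
move=> [[[[a u] [b v]] [c w]] bB [k kin]]; exists ((a, u), (b, v), (c, w)) => //.
exists (- k)%R; have -> : (d + - k * m%:Z = - (- d + k * m%:Z))%R by lia.
move: kin; rewrite /= !inE => /orP[|/orP[|/orP[|/orP[|/orP[]]]]] /eqP[-> -> ->];
  rewrite opprB eqxx ?orbT //.
Qed.

Lemma covers_mod (B : seq (block V)) p q : 0 < m ->
  (forall d : nat, d < m -> covers m B p q d%:Z) -> forall d, covers m B p q d.
Proof.
move=> m_gt0 H d.
have m0 : (m%:Z != 0)%R by lia.
have e : ((d %% m)%Z = `|(d %% m)%Z|%N%:Z)%R by rewrite gez0_abs // modz_ge0.
have lt : `|(d %% m)%Z|%N < m by have := ltz_pmod d (_ : (0 < m%:Z)%R); lia.
have [b bB [k kin]] := H _ lt; exists b => //.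
exists (k - (d %/ m)%Z)%R; move: kin; rewrite -e.
have -> // : (d + (k - (d %/ m)%Z) * m%:Z = (d %% m)%Z + k * m%:Z)%R.
by rewrite {1}(divz_eq d m%:Z) mulrBl; lia.
Qed.

Lemma covers_mem (B B' : seq (block V)) p q d :
  {subset B <= B'} -> covers m B p q d -> covers m B' p q d.
Proof. by move=> sub [b /sub bB H]; exists b. Qed.

Lemma covers_family (I : eqType) (L : seq I) (f : I -> V -> V') B i p q d :
  i \in L -> covers m B p q d ->
  covers m [seq block_map (f i) b | i <- L, b <- B] (f i p) (f i q) d.
Proof.
move=> iL [b bB [k kin]]; exists (block_map (f i) b).
  by apply/allpairsP; exists (i, b).
exists k; case: b kin {bB} => [[[a u] [b v]] [c w]]; rewrite /= !inE.
by move=> /orP[|/orP[|/orP[|/orP[|/orP[]]]]] /eqP[-> -> ->]; rewrite eqxx ?orbT.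
Qed.

(** Certificate for parametric families: a difference is settled by naming the family [j], the
    parameter [x], the position [s] in [block_diffs] and the multiple [k] of [m]. The direct
    constructions below cite these four values. *)
Lemma covers_nth (J : eqType) (L : seq J) (F : J -> nat -> block V) M
    (j : J) (x s : nat) (k : int) p q d :
  j \in L -> x < M -> s < 6 ->
  (p, q, (d + k * m%:Z)%R) = nth (p, p, 0%R) (block_diffs (F j x)) s ->
  covers m [seq F j x | j <- L, x <- iota 0 M] p q d.
Proof.
move=> jL xM s6 e; exists (F j x).
  by apply/allpairsP; exists (j, x); rewrite mem_iota.
by exists k; rewrite e mem_nth //; case: (F j x) => [[[? ?] [? ?]] [? ?]].
Qed.

End Covers.

(** * Decompositions of complete multipartite graphs *)

(* The vertices [(x, e)], [x < h], [e < w], joined when their first coordinates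
   differ, form the complete multipartite graph K_h[w]. *)
Definition decomposes (m w h : nat) := exists2 B : seq (block (nat * nat)),
  6 * size B <= m * (h * h.-1 * w ^ 2)
  & forall x y e f, x < h -> y < h -> x != y -> e < w -> f < w ->
    forall d, covers m B (x, e) (y, f) d.

(** Each triple is lifted in four ways, with copy labels a, b and a + b modulo 2. Any two labels
    determine the third, so every lift of a covered edge occurs, while both sides of the size bound
    grow by the factor 4. *)
Lemma decomposes_double m w h : decomposes m w h -> decomposes m (2 * w) h.
Proof.
move=> [B sB cB].
pose F (ef : bool * bool) (b : block (nat * nat)) : block (nat * nat) :=
  let: (((x, e), u), ((y, f), v), ((z, g), s)) := b in
  (((x, 2 * e + ef.1), u), ((y, 2 * f + ef.2), v), ((z, 2 * g + (ef.1 (+) ef.2)), s)).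
exists [seq F ef b | ef <- [:: (false, false); (false, true); (true, false); (true, true)], b <- B].
  by rewrite size_allpairs /=; move: sB; rewrite expnMn; lia.
move=> x y e f xh yh xy ew fw d.
have ew2 : e./2 < w by lia.
have fw2 : f./2 < w by lia.
have [b bB [k kin]] := cB x y _ _ xh yh xy ew2 fw2 d.
have e2 : e = 2 * e./2 + odd e by lia.
have f2 : f = 2 * f./2 + odd f by lia.
suff [ef kin'] : exists ef, (x, y, e, f, (d + k * m%:Z)%R) \in
   [seq (s.1.1.1, s.1.2.1, s.1.1.2, s.1.2.2, s.2) | s <- block_diffs (F ef b)].
  exists (F ef b).
    by apply/allpairsP; exists (ef, b); split=> //; case: (ef) => [] [] [].
  exists k; case/mapP: kin' => -[[[x' e'] [y' f']] s] /= sin [-> -> -> -> ->].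
  exact: sin.
case: b kin {bB} => [[[[a ea] u] [[b eb] v]] [[c ec] s]]; rewrite /= !inE.
move=> /orP[|/orP[|/orP[|/orP[|/orP[]]]]] /eqP[ex ee ey ef ed];
  [exists (odd e, odd f) | exists (odd e, odd e (+) odd f) | exists (odd e (+) odd f, odd e)
  |exists (odd f, odd e) | exists (odd f, odd e (+) odd f) | exists (odd e (+) odd f, odd f)];
  rewrite /= ed {1}e2 {1}f2 -?ex -?ey -?ee -?ef;
  by case: (odd e); case: (odd f); rewrite !inE /= ?eqxx ?orbT.
Qed.

(** * Direct decompositions of K_4, K_6 and K_3[2] *)

(** Every edge lies in two of the four triangles, each of which carries M triples. Edges 01 and 23
    get the odd differences from one triangle and the even ones from the other; the remaining four
    edges get two complementary cyclic intervals of length M. *)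
Lemma decomposes_K4 M : 0 < M -> decomposes (2 * M) 1 4.
Proof.
move=> M_gt0.
pose F (j x : nat) : block (nat * nat) := nth
  (((2, 0), 0%R), ((0, 0), Posz x), ((1, 0), (- x%:Z - 1)%R))
  [:: (((2, 0), 0%R), ((0, 0), Posz x), ((1, 0), (- x%:Z - 1)%R));
      (((0, 0), 0%R), ((3, 0), Posz x), ((1, 0), (x%:Z + x%:Z)%R));
      (((2, 0), 0%R), ((0, 0), (x%:Z + M%:Z)%R), ((3, 0), (x%:Z + x%:Z)%R));
      (((1, 0), 0%R), ((2, 0), (- x%:Z)%R), ((3, 0), (x%:Z + 1)%R))] j.
exists [seq F j x | j <- iota 0 4, x <- iota 0 M].
  by rewrite size_allpairs !size_iota; lia.
suff H x y : x < y < 4 -> forall d, covers (2 * M) [seq F j x | j <- iota 0 4, x <- iota 0 M] (x, 0) (y, 0) d.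
  move=> x y e f xh yh xy; rewrite !ltnS !leqn0 => /eqP-> /eqP-> d.
  by have [lt|le] := ltnP x y; [|apply: covers_sym]; apply: H; lia.
move=> xy; apply: covers_mod => [|d dm]; first by lia.
have : (x, y) \in [:: (0, 1); (0, 2); (0, 3); (1, 2); (1, 3); (2, 3)].
  by case: x y xy => [|[|[|x]]] [|[|[|[|y]]]] //=; lia.
pose go j x s k := @covers_nth _ (2 * M) _ (iota 0 4) F M j x s k.
rewrite !inE => /orP[|/orP[|/orP[|/orP[|/orP[]]]]] /eqP[-> ->].
- case: (boolP (odd d)) => od.
    by apply: (go 0 (M - (d.+1)./2) 2 (-1)%R) => //=; [lia | congr (_, _, _); lia].
  by apply: (go 1 (d./2) 1 0%R) => //=; [lia | congr (_, _, _); lia].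
- have [le|lt] := leqP d M.
    have [lt|le'] := ltnP 0 d.
      by apply: (go 2 (M - d) 3 (-1)%R) => //=; [lia | congr (_, _, _); lia].
    by apply: (go 0 0 3 0%R) => //=; congr (_, _, _); lia.
  by apply: (go 0 (2 * M - d) 3 (-1)%R) => //=; [lia | congr (_, _, _); lia].
- have [lt|le] := ltnP d M.
    by apply: (go 1 d 0 0%R) => //=; congr (_, _, _); lia.
  by apply: (go 2 (d - M) 2 (-1)%R) => //=; [lia | congr (_, _, _); lia].
(* The differences [x + 1] and [- x] fill [1, M] and its complement, so the cut is after M and d = 0
   belongs to the second half. *)
- have [lt|le] := ltnP d M.+1.
    have [lt'|le'] := ltnP 0 d.
      by apply: (go 0 (d - 1) 4 0%R) => //=; [lia | congr (_, _, _); lia].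
    by apply: (go 3 0 0 0%R) => //=; congr (_, _, _); lia.
  by apply: (go 3 (2 * M - d) 0 (-1)%R) => //=; [lia | congr (_, _, _); lia].
- have [lt|le] := ltnP d M.+1.
    have [lt'|le'] := ltnP 0 d.
      by apply: (go 3 (d - 1) 1 0%R) => //=; [lia | congr (_, _, _); lia].
    by apply: (go 1 0 5 0%R) => //=; congr (_, _, _); lia.
  by apply: (go 1 (2 * M - d) 5 (-1)%R) => //=; [lia | congr (_, _, _); lia].
- case: (boolP (odd d)) => od.
    by apply: (go 3 (d./2) 2 0%R) => //=; [lia | congr (_, _, _); lia].
  by apply: (go 2 (d./2) 1 0%R) => //=; [lia | congr (_, _, _); lia].
Qed.

(** The triangles {5, i, i+1} and {i, i+1, i+3}, with i in Z_5, contain every edge twice. Up to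
    sign, an edge {i, i+1} gets the odd differences 2x + 1 from the first kind and 2x + M from the
    second, even because M is; every other edge gets two intervals of length M. *)
Lemma decomposes_K6 M : 0 < M -> ~~ odd M -> decomposes (2 * M) 1 6.
Proof.
move=> M_gt0 oM.
pose c i := if i < 5 then i else i - 5.
pose F (j : bool * nat) (x : nat) : block (nat * nat) := if j.1 then
  (((5, 0), 0%R), ((j.2, 0), Posz x), ((c j.2.+1, 0), (- x%:Z - 1)%R)) else
  (((c j.2.+1, 0), 0%R), ((c (j.2 + 3), 0), Posz x), ((j.2, 0), (x%:Z + x%:Z + M%:Z)%R)).
pose L := [seq (b, i) | b <- [:: true; false], i <- iota 0 5].
exists [seq F j x | j <- L, x <- iota 0 M].
  by rewrite size_allpairs size_iota /=; lia.
pose go j x s k := @covers_nth _ (2 * M) _ L F M j x s k.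
pose C p q := forall d, covers (2 * M) [seq F j x | j <- L, x <- iota 0 M] p q d.
have C1 i : i < 5 -> C (i, 0) (c i.+1, 0).
  move=> i5; apply: covers_mod => [|d dm]; first by lia.
  have iL b : (b, i) \in L by apply/allpairsP; exists (b, i); rewrite mem_iota; case: b.
  case: (boolP (odd d)) => od.
    by apply: (go (true, i) (M - (d.+1)./2) 2 (-1)%R) => //=; [lia | congr (_, _, _); lia].
  have [le|lt] := leqP d M.
    have [lt|le'] := ltnP 0 d.
      by apply: (go (false, i) ((M - d)./2) 4 (-1)%R) => //=; [lia | congr (_, _, _); lia].
    by apply: (go (false, i) (M./2) 4 (-1)%R) => //=; [lia | congr (_, _, _); lia].
  by apply: (go (false, i) (M./2 + M - d./2) 4 (-2)%R) => //=; [lia | congr (_, _, _); lia].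
have C2 i : i < 5 -> C (i, 0) (c (i + 2), 0).
  move=> i5; apply: covers_mod => [|d dm]; first by lia.
  have [lt|le] := ltnP d M.
    apply: (go (false, c (i + 4)) d 0 0%R) => //=.
      by apply/allpairsP; exists (false, c (i + 4)); rewrite mem_iota /c; split=> //=; case: ifP; lia.
    by rewrite /c; do ?congr (_, _); do ?case: ifP; lia.
  apply: (go (false, c (i + 2)) (d - M) 2 0%R) => //=.
  - by apply/allpairsP; exists (false, c (i + 2)); rewrite mem_iota /c; split=> //=; case: ifP; lia.
  - by lia.
  by rewrite /c; do ?congr (_, _); do ?case: ifP; lia.
have C3 i : i < 5 -> C (5, 0) (i, 0).
  move=> i5; apply: covers_mod => [|d dm]; first by lia.
  have [lt|le] := ltnP d M.
    have iL : (true, i) \in L by apply/allpairsP; exists (true, i); rewrite mem_iota.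
    by apply: (go (true, i) d 0 0%R) => //=; do ?congr (_, _); lia.
  apply: (go (true, c (i + 4)) (2 * M - d.+1) 1 (-1)%R) => //=.
  - by apply/allpairsP; exists (true, c (i + 4)); rewrite mem_iota /c; split=> //=; case: ifP; lia.
  - by lia.
  by rewrite /c; do ?congr (_, _); do ?case: ifP; lia.
move=> x y e f xh yh xy; rewrite !ltnS !leqn0 => /eqP-> /eqP-> d.
have [x5|] := ltnP x 5; last first.
  by move=> x5; have -> : x = 5 by [lia]; apply: C3; lia.
have [y5|] := ltnP y 5; last first.
  by move=> y5; have -> : y = 5 by [lia]; apply: covers_sym; apply: C3; lia.
suff: [\/ y = c x.+1, y = c (x + 2), x = c y.+1 | x = c (y + 2)].
  by case=> ->; [apply: C1 | apply: C2 | apply: covers_sym; apply: C1 | apply: covers_sym; apply: C2].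
move: x y x5 y5 xy {xh yh}.
by case=> [|[|[|[|[|x]]]]] [|[|[|[|[|y]]]]] //= _ _ _;
  first [constructor 1; reflexivity | constructor 2; reflexivity | constructor 3; reflexivity | constructor 4; reflexivity].
Qed.

(** One family per face of the octahedron. The edge from (0, e) to (1, f) gets its even differences
    from the face with apex (2, 1) and its odd ones from the face with apex (2, 0); adding M keeps
    the parity. An edge into group 2 lies in two faces that differ in the bit [e] or [f] of the
    third vertex, and the offset M chosen by that bit separates the two intervals. *)
Lemma decomposes_octahedron M : 0 < M -> ~~ odd M -> decomposes (2 * M) 2 3.
Proof.
move=> M_gt0 oM.
pose F (j : bool * bool * bool) (x : nat) : block (nat * nat) :=
  let: (e, f, g) := j in let: (eM, fM) := (if e then Posz M else 0%R, if f then Posz M else 0%R) in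
  if g then (((0, nat_of_bool e), 0%R), ((1, nat_of_bool f), (x%:Z + x%:Z + eM + fM)%R), ((2, 1), (x%:Z + fM)%R))
  else (((0, nat_of_bool e), (x%:Z + fM)%R), ((1, nat_of_bool f), (- x%:Z - 1 + eM)%R), ((2, 0), 0%R)).
pose bs := [:: true; false].
pose L := [seq (ef, g) | ef <- [seq (e, f) | e <- bs, f <- bs], g <- bs].
exists [seq F j x | j <- L, x <- iota 0 M].
  by rewrite size_allpairs size_iota /=; lia.
pose go j x s k := @covers_nth _ (2 * M) _ L F M j x s k.
pose C p q := forall d, covers (2 * M) [seq F j x | j <- L, x <- iota 0 M] p q d.
have jL j : j \in L by case: j => [[[] []] []].
have C1 e f : C (0, nat_of_bool e) (1, nat_of_bool f).
  apply: covers_mod => [|d dm]; first by lia.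
  case: (boolP (odd d)) => od.
    have [lt|le] := ltnP d M.
      case: e f => [] [].
      + by apply: (go (true, true, false) (M - (d.+1)./2) 0 (-1)%R) => //=; [lia | congr (_, _, _); lia].
      + by apply: (go (true, false, false) (M./2 - (d.+1)./2) 0 0%R) => //=; [lia | congr (_, _, _); lia].
      + by apply: (go (false, true, false) (M./2 - (d.+1)./2) 0 (-1)%R) => //=; [lia | congr (_, _, _); lia].
      by apply: (go (false, false, false) (M - (d.+1)./2) 0 (-1)%R) => //=; [lia | congr (_, _, _); lia].
    case: e f => [] [].
    + by apply: (go (true, true, false) (M - (d.+1)./2) 0 (-1)%R) => //=; [lia | congr (_, _, _); lia].
    + by apply: (go (true, false, false) (M./2 + M - (d.+1)./2) 0 (-1)%R) => //=; [lia | congr (_, _, _); lia].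
    + by apply: (go (false, true, false) (M./2 + M - (d.+1)./2) 0 (-2)%R) => //=; [lia | congr (_, _, _); lia].
    by apply: (go (false, false, false) (M - (d.+1)./2) 0 (-1)%R) => //=; [lia | congr (_, _, _); lia].
  have [lt|le] := ltnP d M.
    case: e f => [] [].
    + by apply: (go (true, true, true) (d./2) 0 1%R) => //=; [lia | congr (_, _, _); lia].
    + by apply: (go (true, false, true) (M./2 + d./2) 0 1%R) => //=; [lia | congr (_, _, _); lia].
    + by apply: (go (false, true, true) (M./2 + d./2) 0 1%R) => //=; [lia | congr (_, _, _); lia].
    by apply: (go (false, false, true) (d./2) 0 0%R) => //=; [lia | congr (_, _, _); lia].
  case: e f => [] [].
  + by apply: (go (true, true, true) (d./2) 0 1%R) => //=; [lia | congr (_, _, _); lia].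
  + by apply: (go (true, false, true) (d./2 - M./2) 0 0%R) => //=; [lia | congr (_, _, _); lia].
  + by apply: (go (false, true, true) (d./2 - M./2) 0 0%R) => //=; [lia | congr (_, _, _); lia].
  by apply: (go (false, false, true) (d./2) 0 0%R) => //=; [lia | congr (_, _, _); lia].
have C2 e g : C (0, nat_of_bool e) (2, nat_of_bool g).
  apply: covers_mod => [|d dm]; first by lia.
  case: g.
    have [lt|le] := ltnP d M.
      by apply: (go (e, false, true) d 1 0%R) => //=; congr (_, _, _); lia.
    by apply: (go (e, true, true) (d - M) 1 0%R) => //=; [lia | congr (_, _, _); lia].
  have [lt|le] := ltnP M d.
    by apply: (go (e, false, false) (2 * M - d) 1 (-1)%R) => //=; [lia | congr (_, _, _); lia].
  have [lt'|le'] := ltnP 0 d.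
    by apply: (go (e, true, false) (M - d) 1 (-1)%R) => //=; [lia | congr (_, _, _); lia].
  by apply: (go (e, false, false) 0 1 0%R) => //=; congr (_, _, _); lia.
have C3 f g : C (1, nat_of_bool f) (2, nat_of_bool g).
  apply: covers_mod => [|d dm]; first by lia.
  case: g.
    have [lt|le] := ltnP M d.
      by apply: (go (false, f, true) (2 * M - d) 2 (-1)%R) => //=; [lia | congr (_, _, _); lia].
    have [lt'|le'] := ltnP 0 d.
      by apply: (go (true, f, true) (M - d) 2 (-1)%R) => //=; [lia | congr (_, _, _); lia].
    by apply: (go (false, f, true) 0 2 0%R) => //=; congr (_, _, _); lia.
  have [lt|le] := ltnP M d.
    by apply: (go (true, f, false) (d - M - 1) 2 (-1)%R) => //=; [lia | congr (_, _, _); lia].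
  have [lt'|le'] := ltnP 0 d.
    by apply: (go (false, f, false) (d - 1) 2 0%R) => //=; [lia | congr (_, _, _); lia].
  by apply: (go (true, f, false) (M - 1) 2 0%R) => //=; [lia | congr (_, _, _); lia].
have bit e : e < 2 -> exists b : bool, e = b :> nat.
  by case: e => [|[|e]] // _; [exists false | exists true].
move=> x y e f xh yh xy /bit[e' ->] /bit[f' ->] d.
move: x y xh yh xy; case=> [|[|[|x]]] [|[|[|y]]] //= _ _ _;
  first [exact: C1 | exact: C2 | exact: C3 | apply: covers_sym; first [exact: C1 | exact: C2 | exact: C3]].
Qed.

(** * Blowing up triple systems and filling in groups *)

(** Every vertex is doubled and every triple receives a copy of the decomposition of K_3[2]. Only
    covering is asked of [L]: the size bound then forces each pair to occur once. *)
Lemma decomposes_triples m c h (L : seq (seq (nat * nat))) :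
  decomposes m 2 3 -> {in L, forall l, size l = 3} ->
  6 * size L <= h * h.-1 * c ^ 2 ->
  (forall x i y j, x < h -> y < h -> i < c -> j < c -> x != y ->
     exists2 l, l \in L & ((x, i) \in l) && ((y, j) \in l)) ->
  decomposes m (2 * c) h.
Proof.
move=> [B sB cB] L3 sL cL.
pose f (l : seq (nat * nat)) (ae : nat * nat) :=
  let: (x, i) := nth (0, 0) l ae.1 in (x, 2 * i + ae.2).
exists [seq block_map (f l) b | l <- L, b <- B].
  rewrite size_allpairs expnMn; have := leq_mul (leqnn (size L)) sB.
  have := leq_mul (leqnn (4 * m)) sL; lia.
move=> x y e g xh yh xy ew gw d.
have ec : e./2 < c by lia.
have gc : g./2 < c by lia.
have [l lL /andP[xl yl]] := cL x e./2 y g./2 xh yh ec gc xy.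
have <- : f l (index (x, e./2) l, nat_of_bool (odd e)) = (x, e).
  by rewrite /f nth_index //=; congr pair; lia.
have <- : f l (index (y, g./2) l, nat_of_bool (odd g)) = (y, g).
  by rewrite /f nth_index //=; congr pair; lia.
apply: covers_family => //; apply: cB; rewrite -?(L3 l lL) ?index_mem //; try lia.
apply: contraNN xy => /eqP e_ind; have := congr1 (nth (0, 0) l) e_ind.
by rewrite !nth_index // => -[->].
Qed.

(** A group of [2 * g] vertices is read as [g] pairs. The first decomposition handles different
    groups; each group, enlarged when [eps] holds by one extra pair common to all groups, is filled
    with a copy of the second. *)
Lemma decomposes_compose m (eps : bool) g h :
  decomposes m (2 * g) h -> decomposes m 2 (g + eps) -> decomposes m 2 (h * g + eps).
Proof.
move=> [B1 sB1 cB1] [B2 sB2 cB2].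
pose f1 (_ : unit) (xE : nat * nat) := (xE.1 * g + xE.2./2, nat_of_bool (odd xE.2)).
(* The index [g], in range only when [eps] holds, goes to the common pair [h * g] for every [x]. *)
pose f2 x (ye : nat * nat) := (if ye.1 < g then x * g + ye.1 else h * g, ye.2).
exists ([seq block_map (f1 i) b | i <- [:: tt], b <- B1] ++
        [seq block_map (f2 i) b | i <- iota 0 h, b <- B2]).
  rewrite size_cat !size_allpairs size_iota /= mul1n.
  have := leq_mul (leqnn h) sB2.
  move: sB1; rewrite expnMn; case: eps {sB2 cB2 cB1} => /=; rewrite ?addn1 ?addn0 /=.
    by case: h {f2} => [|h] /=; lia.
  by case: h {f2} => [|h] /=; case: g {f1} => [|g] /=; rewrite ?muln0 //=; lia.
move=> X Y e f Xh Yh XY ew fw d.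
have [g0|g_gt0] := posnP g; first by move: Xh Yh XY; rewrite {1 2}g0 muln0; case: (eps); lia.
have ltg Z : Z %% g < g by rewrite ltn_pmod.
have f2E Z x s : Z < h * g -> x = Z %/ g -> f2 x (Z %% g, s) = (Z, s).
  by move=> Zh ->; rewrite /f2 /= ltg -divn_eq.
have inf2 x Z W s r : x < h -> Z < g + eps -> W < g + eps -> Z != W -> s < 2 -> r < 2 ->
    covers m ([seq block_map (f1 i) b | i <- [:: tt], b <- B1] ++
        [seq block_map (f2 i) b | i <- iota 0 h, b <- B2]) (f2 x (Z, s)) (f2 x (W, r)) d.
  move=> xh Zg Wg ZW s2 r2.
  apply: (@covers_mem _ _ [seq block_map (f2 i) b | i <- iota 0 h, b <- B2]).
    by move=> b bB; rewrite mem_cat bB orbT.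
  by apply: covers_family; [rewrite mem_iota | apply: cB2].
have divh Z : Z < h * g -> Z %/ g < h by move=> ?; rewrite ltn_divLR.
have lteps Z : Z %% g < g + eps by rewrite (leq_trans (ltg Z)) ?leq_addr.
have [Xlt|Xge] := ltnP X (h * g); last first.
  have e1 : eps by case: (eps) Xh; lia.
  have Ylt : Y < h * g by move: Xh Yh; rewrite e1; lia.
  rewrite -(f2E Y (Y %/ g)) //.
  have -> : (X, e) = f2 (Y %/ g) (g, e) by rewrite /f2 /= ltnn; congr pair; move: Xh; rewrite e1; lia.
  by apply: inf2 => //; rewrite ?divh ?e1 ?addn1 // gtn_eqF.
have [Ylt|Yge] := ltnP Y (h * g); last first.
  have e1 : eps by case: (eps) Yh; lia.
  rewrite -(f2E X (X %/ g)) //.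
  have -> : (Y, f) = f2 (X %/ g) (g, f) by rewrite /f2 /= ltnn; congr pair; move: Yh; rewrite e1; lia.
  by apply: inf2 => //; rewrite ?divh ?e1 ?addn1 // ltn_eqF.
have [eq_div|neq_div] := eqVneq (X %/ g) (Y %/ g).
  rewrite -(f2E X (X %/ g)) // -(f2E Y (X %/ g)) //.
  apply: inf2 => //; first exact: divh.
  by apply: contraNN XY => /eqP eq_mod; rewrite (divn_eq X g) (divn_eq Y g) eq_div eq_mod.
apply: (@covers_mem _ _ [seq block_map (f1 i) b | i <- [:: tt], b <- B1]).
  by move=> b bB; rewrite mem_cat bB.
have f1E' a b s : s < 2 -> f1 tt (a, 2 * b + s) = (a * g + b, s).
  by move=> s2; rewrite /f1 /=; congr (_ + _, _); lia.
have f1E Z s : s < 2 -> f1 tt (Z %/ g, 2 * (Z %% g) + s) = (Z, s).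
  by move=> s2; rewrite f1E' // -divn_eq.
rewrite -(f1E X e) // -(f1E Y f) //.
apply: covers_family => //; apply: cB1 => //; rewrite ?divh //.
- by move: (X %% g) (ltg X) => ?; clear -ew; lia.
- by move: (Y %% g) (ltg Y) => ?; clear -fw; lia.
Qed.

(** * Bose's and Skolem's triple systems *)

Definition cyc_add u a b := if a + b < u then a + b else a + b - u.

Definition next3 i := if i == 2 then 0 else i.+1.

Lemma next3_cases i j : i < 3 -> j < 3 -> [\/ j = i, j = next3 i | i = next3 j].
Proof.
by move: i j; case=> [|[|[|i]]] [|[|[|j]]] //= _ _;
  first [constructor 1; reflexivity | constructor 2; reflexivity | constructor 3; reflexivity].
Qed.

(* The blocks of Bose's construction, indexed by the midpoint [x] of the two
   points on level [i] and half their distance. *)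
Lemma decomposes_bose m v : decomposes m 2 3 -> decomposes m 6 v.*2.+1.
Proof.
set u := v.*2.+1.
pose T (z : nat * nat * nat) := let: (x, dl, i) := z in
  [:: (cyc_add u x dl, i); (cyc_add u x (u - dl), i); (x, next3 i)].
(* The triples (x, 0), (x, 1), (x, 2) of Bose's system are absent: they are the groups, which have
   no inner edges. *)
pose L := [seq T (xd, i) | xd <- [seq (x, dl) | x <- iota 0 u, dl <- iota 1 v], i <- iota 0 3].
move=> dec; apply: (@decomposes_triples m 3 u L) => //.
- by move=> l /allpairsP[[[x dl] i] /= [_ _ ->]].
- by rewrite !size_allpairs !size_iota /u /=; lia.
have TL x dl i : x < u -> 0 < dl <= v -> i < 3 -> T (x, dl, i) \in L.
  move=> xu dv i3; apply/allpairsP; exists ((x, dl), i); rewrite mem_iota; split=> //.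
  by apply/allpairsP; exists (x, dl); rewrite !mem_iota; split=> //=; lia.
have flat x y i : x < y < u -> i < 3 -> exists2 l, l \in L & ((x, i) \in l) && ((y, i) \in l).
  move=> xy i3; case: (boolP (odd (y - x))) => oyx.
    (* As [u] is odd, the arc from y to x the other way round has even length, hence a midpoint. *)
    exists (T (cyc_add u y ((u - (y - x))./2), (u - (y - x))./2, i)).
      by apply: TL => //; rewrite /cyc_add; [case: ifP | ]; lia.
    apply/andP; split; rewrite /T !inE.
      by apply/orP; left; apply/eqP; congr pair; rewrite /cyc_add; do !case: ifP; lia.
    by apply/orP; right; apply/orP; left; apply/eqP; congr pair; rewrite /cyc_add; do !case: ifP; lia.
  exists (T (x + (y - x)./2, (y - x)./2, i)).
    by apply: TL => //; lia.
  apply/andP; split; rewrite /T !inE.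
    by apply/orP; right; apply/orP; left; apply/eqP; congr pair; rewrite /cyc_add; do !case: ifP; lia.
  by apply/orP; left; apply/eqP; congr pair; rewrite /cyc_add; do !case: ifP; lia.
have up x y i : x < u -> y < u -> x != y -> i < 3 ->
    exists2 l, l \in L & ((x, i) \in l) && ((y, next3 i) \in l).
  move=> xu yu xy i3.
  (* [D] is x - y in Z_u; the midpoint is the apex y, and half the distance is D or -D, whichever is
     at most [v]. *)
  pose D := cyc_add u x (u - y).
  have [le|lt] := leqP D v.
    exists (T (y, D, i)); first by apply: TL => //; move: le; rewrite /D /cyc_add; do !case: ifP; lia.
    rewrite /T !inE eqxx !orbT andbT; apply/orP; left; apply/eqP; congr pair.
    by rewrite /D /cyc_add; do !case: ifP; lia.
  exists (T (y, u - D, i)); first by apply: TL => //; move: lt; rewrite /D /cyc_add; do !case: ifP; lia.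
  rewrite /T !inE eqxx !orbT andbT; apply/orP; right; apply/orP; left; apply/eqP; congr pair.
  by rewrite /D /cyc_add; do !case: ifP; lia.
move=> x i y j xu yu i3 j3 xy; have [ji|ji|ij] := next3_cases i3 j3.
- rewrite ji; have [lt|le] := ltnP x y; first by apply: flat; rewrite ?lt.
  by have [|l lL /andP[h1 h2]] := @flat y x i _ i3; [lia | exists l; rewrite ?h1 ?h2].
- by rewrite ji; apply: up.
- rewrite ij; have [|l lL /andP[h1 h2]] := @up y x j yu xu _ j3; first by rewrite eq_sym.
  by exists l; rewrite ?h1 ?h2.
Qed.

(* Skolem's Steiner triple system; the pairs [{p, q}] on a level of Z_2k whose
   sum is [2x] or [2x + 1], with [x < k], share the apex [x], resp. [x + k]. *)
Lemma decomposes_skolem m k : decomposes m 2 3 -> decomposes m 2 (6 * k).+1.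
Proof.
pose u := 2 * k.
pose vx x i : nat * nat := (3 * x + i, 0).
pose T1 (z : nat * nat * nat) := let: (x, dl, i) := z in
  [:: vx (cyc_add u x dl) i; vx (cyc_add u x (u - dl)) i; vx x (next3 i)].
pose T2 (z : nat * nat * nat) := let: (x, dl, i) := z in
  [:: vx (cyc_add u x dl.+1) i; vx (cyc_add u x (u - dl)) i; vx (x + k) (next3 i)].
(* In Z_2k the equation 2p = 2x has the solutions x and x + k, which [T1] leaves unpaired under the
   apex x. [T3] joins the first to the apex; [T4] joins the second, together with the point at
   infinity [6 * k]. *)
pose T3 x := [:: vx x 0; vx x 1; vx x 2].
pose T4 (z : nat * nat) := let: (x, i) := z in
  [:: (6 * k, 0); vx (x + k) i; vx x (next3 i)].
pose L1 := [seq T1 (xd, i) | xd <- [seq (x, dl) | x <- iota 0 k, dl <- iota 1 k.-1], i <- iota 0 3].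
pose L2 := [seq T2 (xd, i) | xd <- [seq (x, dl) | x <- iota 0 k, dl <- iota 0 k], i <- iota 0 3].
pose L3 := [seq T3 x | x <- iota 0 k].
pose L4 := [seq T4 (x, i) | x <- iota 0 k, i <- iota 0 3].
pose L := L1 ++ L2 ++ L3 ++ L4.
move=> dec; apply: (@decomposes_triples m 1 (6 * k).+1 L) => //.
- move=> l; rewrite !mem_cat => /orP[|/orP[|/orP[]]].
  + by case/allpairsP=> -[[x dl] i] [_ _ ->].
  + by case/allpairsP=> -[[x dl] i] [_ _ ->].
  + by case/mapP=> x _ ->.
  + by case/allpairsP=> -[x i] [_ _ ->].
- rewrite !size_cat size_map !size_allpairs !size_iota /=.
  by case: k {u vx T1 T2 T3 T4 L1 L2 L3 L4 L} => [|k] //=; lia.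
have TL1 x dl i : x < k -> 0 < dl < k -> i < 3 -> T1 (x, dl, i) \in L.
  move=> xu dv i3; rewrite mem_cat; apply/orP; left.
  apply/allpairsP; exists ((x, dl), i); rewrite mem_iota; split=> //.
  by apply/allpairsP; exists (x, dl); rewrite !mem_iota; split=> //=; lia.
have TL2 x dl i : x < k -> dl < k -> i < 3 -> T2 (x, dl, i) \in L.
  move=> xu dv i3; rewrite mem_cat mem_cat; apply/orP; right; apply/orP; left.
  apply/allpairsP; exists ((x, dl), i); rewrite mem_iota; split=> //.
  by apply/allpairsP; exists (x, dl); rewrite !mem_iota; split=> //=; lia.
have TL3 x : x < k -> T3 x \in L.
  by move=> xk; rewrite !mem_cat map_f ?orbT // mem_iota.
have TL4 x i : x < k -> i < 3 -> T4 (x, i) \in L.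
  move=> xk i3; rewrite !mem_cat; apply/orP; right; apply/orP; right; apply/orP; right.
  by apply/allpairsP; exists (x, i); rewrite !mem_iota.
pose C p q := exists2 l, l \in L & (p \in l) && (q \in l).
have C_sym p q : C p q -> C q p by case=> l lL /andP[h1 h2]; exists l; rewrite ?h1 ?h2.
have flat x y i : x < y < u -> i < 3 -> C (vx x i) (vx y i).
  move=> xy i3; have [lt|le] := ltnP (x + y)./2 k; case: (boolP (odd (x + y))) => oyx.
  - exists (T2 ((x + y)./2, (y - x)./2, i)); first by apply: TL2; lia.
    rewrite /T2 !inE; apply/andP; split; apply/orP; [right; apply/orP; left | left];
      by apply/eqP; congr (vx _ _); rewrite /cyc_add; case: ifP; lia.
  - exists (T1 ((x + y)./2, (y - x)./2, i)); first by apply: TL1; lia.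
    rewrite /T1 !inE; apply/andP; split; apply/orP; [right; apply/orP; left | left];
      by apply/eqP; congr (vx _ _); rewrite /cyc_add; case: ifP; lia.
  (* A sum that reaches 2k is reduced: the midpoint drops by k and the distance is measured the
     other way round, which exchanges the two points. *)
  - exists (T2 ((x + y)./2 - k, k.-1 - (y - x)./2, i)); first by apply: TL2; lia.
    rewrite /T2 !inE; apply/andP; split; apply/orP; [left | right; apply/orP; left];
      by apply/eqP; congr (vx _ _); rewrite /cyc_add; case: ifP; lia.
  - exists (T1 ((x + y)./2 - k, k - (y - x)./2, i)); first by apply: TL1; lia.
    rewrite /T1 !inE; apply/andP; split; apply/orP; [left | right; apply/orP; left];
      by apply/eqP; congr (vx _ _); rewrite /cyc_add; case: ifP; lia.
have up x y i : x < u -> y < u -> i < 3 -> C (vx x i) (vx y (next3 i)).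
  move=> xu yu i3; have [yk|ky] := ltnP y k.
    have [->|xy] := eqVneq x y.
      exists (T3 y); first exact: TL3.
      by rewrite /T3 !inE; case: i i3 => [|[|[|i]]] // _; rewrite !eqxx ?orbT.
    have [->|xyk] := eqVneq x (y + k).
      by exists (T4 (y, i)); [apply: TL4 | rewrite /T4 !inE !eqxx ?orbT].
    pose D := cyc_add u x (u - y).
    have [lt|le] := ltnP D k.
      exists (T1 (y, D, i)); first by apply: TL1 => //; move: lt; rewrite /D /cyc_add; do !case: ifP; lia.
      rewrite /T1 !inE eqxx !orbT andbT; apply/orP; left; apply/eqP; congr (vx _ _).
      by rewrite /D /cyc_add; do !case: ifP; lia.
    exists (T1 (y, u - D, i)); first by apply: TL1 => //; move: le; rewrite /D /cyc_add; do !case: ifP; lia.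
    rewrite /T1 !inE eqxx !orbT andbT; apply/orP; right; apply/orP; left; apply/eqP; congr (vx _ _).
    by move: le; rewrite /D /cyc_add; do !case: ifP; lia.
  pose y' := y - k; have -> : y = y' + k by lia.
  have y'k : y' < k by lia.
  pose D := cyc_add u x (u - y').
  have [D0|D0] := posnP D.
    exists (T2 (y', 0, i)); first by apply: TL2 => //; lia.
    rewrite /T2 !inE eqxx !orbT andbT; apply/orP; right; apply/orP; left; apply/eqP; congr (vx _ _).
    by move: D0; rewrite /D /cyc_add; do !case: ifP; lia.
  have [le|lt] := leqP D k.
    exists (T2 (y', D.-1, i)); first by apply: TL2 => //; lia.
    rewrite /T2 !inE eqxx !orbT andbT; apply/orP; left; apply/eqP; congr (vx _ _).
    by move: D0; rewrite /D /cyc_add; do !case: ifP; lia.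
  exists (T2 (y', u - D, i)); first by apply: TL2 => //; lia.
  rewrite /T2 !inE eqxx !orbT andbT; apply/orP; right; apply/orP; left; apply/eqP; congr (vx _ _).
  by move: lt; rewrite /D /cyc_add; do !case: ifP; lia.
have infty x i : x < u -> i < 3 -> C (6 * k, 0) (vx x i).
  move=> xu i3; have [lt|le] := ltnP x k.
    have [j j3 ->] : exists2 j, j < 3 & i = next3 j.
      by case: i i3 => [|[|[|i]]] // _; [exists 2 | exists 0 | exists 1].
    by exists (T4 (x, j)); [apply: TL4 | rewrite /T4 !inE !eqxx ?orbT].
  exists (T4 (x - k, i)); first by apply: TL4; lia.
  by rewrite /T4 subnK // !inE !eqxx ?orbT.
have vxE X : (X, 0) = vx (X %/ 3) (X %% 3) by rewrite /vx; congr pair; lia.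
move=> X i Y j XV YV; rewrite !ltnS !leqn0 => /eqP-> /eqP-> XY; rewrite -/(C _ _).
have [Xlt|Xge] := ltnP X (6 * k); last first.
  by have -> : X = 6 * k; [lia | rewrite (vxE Y); apply: infty; lia].
have [Ylt|Yge] := ltnP Y (6 * k); last first.
  by have -> : Y = 6 * k; [lia | rewrite (vxE X); apply: C_sym; apply: infty; lia].
rewrite (vxE X) (vxE Y).
have lt3 Z : Z %% 3 < 3 by lia.
have ltu Z : Z < 6 * k -> Z %/ 3 < u by lia.
have [e|e|e] := next3_cases (lt3 X) (lt3 Y); rewrite e.
- have [lt|le] := ltnP (X %/ 3) (Y %/ 3); first by apply: flat; rewrite ?lt ?ltu.
  by apply: C_sym; apply: flat; lia.
- by apply: up; rewrite ?ltu.
- by apply: C_sym; apply: up; rewrite ?ltu.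
Qed.

(** * All admissible numbers of pairs of rows *)

(** Modulo 12, Skolem's system gives 1 and 7; Bose's system gives 3 and 9 with groups of 3 pairs, 4
    and 10 with an extra pair, and, doubled, 6 with groups of 6. Only h = 0 modulo 12 recurses, to h
    / 4, which is again divisible by 3. *)
Lemma decomposes_pairs M h : 0 < M -> ~~ odd M ->
  h %% 3 = 0 \/ h %% 3 = 1 -> decomposes (2 * M) 2 h.
Proof.
move=> M_gt0 oM.
have oct := decomposes_octahedron M_gt0 oM.
have dec4 := decomposes_double (decomposes_K4 M_gt0).
have dec6 := decomposes_double (decomposes_K6 M_gt0 oM).
elim/ltn_ind: h => h IH h3.
have [h0|h_gt0] := posnP h; first by exists [::] => // x y e f; rewrite h0.
have [h1|h1] := eqVneq (h %% 6) 1.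
  have -> : h = (6 * (h %/ 6)).+1 by lia.
  exact: decomposes_skolem.
have [h2|h2] := eqVneq (h %% 6) 3.
  have -> : h = (h %/ 6).*2.+1 * 3 + false by lia.
  by apply: decomposes_compose; [apply: decomposes_bose|].
have [h4|h4] := eqVneq (h %% 6) 4.
  have -> : h = (h %/ 6).*2.+1 * 3 + true by lia.
  by apply: decomposes_compose; [apply: decomposes_bose|].
have [h6|h6] := eqVneq (h %% 12) 6.
  have -> : h = (h %/ 12).*2.+1 * 6 + false by lia.
  by apply: decomposes_compose => //; apply: (@decomposes_double _ 6); apply: decomposes_bose.
have -> : h = h %/ 4 * 4 + false by lia.
apply: decomposes_compose => //; apply: (@decomposes_double _ 4); apply: (@decomposes_double _ 2).
by apply: IH; lia.
Qed.

(** * The starter on two rows, and all blocks together *)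

(** The bound is tight: 12t + 4 mixed differences in each direction and 12t + 2 pure ones in each
    row make 6(8t + 2). In the proof, [A p q] accounts for the mixed differences p and q and for q -
    p in row 0, [B p q] for p + M and q + M and for q - p in row 1. *)
Lemma two_row_blocks t : exists2 B : seq (block nat),
  size B <= 8 * t + 2 &
  (forall d, covers (12 * t + 4) B 0 1 d) /\
  forall e d, e < 2 -> 0 < d < 12 * t + 4 -> d != 6 * t + 2 -> covers (12 * t + 4) B e e (Posz d).
Proof.
pose M := 6 * t + 2; pose m := 12 * t + 4.
(* The pairs [{p, q}] used below partition Z_M; together with their translates by
   [M] they partition Z_m, and their differences are the ones, in both rows, that
   the triples [{0, 2j, 3t + 1 + j}] inside a row leave over. *)
pose A p q : block nat := ((0, 0%R), (0, (Posz q - Posz p)%R), (1, Posz q)).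
pose B p q : block nat := ((0, 0%R), (1, Posz (p + M)), (1, Posz (q + M))).
pose F (j x : nat) : block nat := nth ((0, 0%R), (0, Posz (2 * x.+1)), (0, Posz (3 * t + 2 + x)))
  [:: ((0, 0%R), (0, Posz (2 * x.+1)), (0, Posz (3 * t + 2 + x)));
      ((1, 0%R), (1, Posz (2 * x.+1)), (1, Posz (3 * t + 2 + x)));
      A (t.+1 + x) (3 * t - x); B (t.+1 + x) (3 * t - x);
      (* Adding M to the second point respects the partition modulo M and turns the difference 2x +
         1 - 2t, whose absolute value the preceding pairs already use, into 4t + 3 + 2x. *)
      A (5 * t + 1 - x) (3 * t + 2 + x + M); B (5 * t + 1 - x) (3 * t + 2 + x + M);
      A x.+1 (6 * t + 1 - x); B x.+1 (6 * t + 1 - x)] j.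
pose B1 := [seq F j x | j <- iota 0 8, x <- iota 0 t].
pose B2 := [:: A 0 (3 * t + 1); B 0 (3 * t + 1)].
exists (B1 ++ B2); first by rewrite size_cat size_allpairs !size_iota /=; lia.
have go j x s k p q d : j \in iota 0 8 -> x < t -> s < 6 ->
    (p, q, (d + k * m%:Z)%R) = nth (p, p, 0%R) (block_diffs (F j x)) s -> covers m (B1 ++ B2) p q d.
  move=> jL xt s6 E; apply: (@covers_mem _ _ B1) (covers_nth jL xt s6 E).
  by move=> b bB; rewrite mem_cat bB.
have go2 j k p q d : (p, q, (d + k * m%:Z)%R) \in block_diffs (nth (A 0 (3 * t + 1)) B2 j) -> j < 2 ->
    covers m (B1 ++ B2) p q d.
  move=> E j2; exists (nth (A 0 (3 * t + 1)) B2 j); last by exists k.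
  by rewrite mem_cat mem_nth ?orbT.
have in_nth s p q (d : int) l : s < size l -> (p, q, d) = nth (0, 0, 0%R) l s -> (p, q, d) \in l.
  by move=> sl ->; apply: mem_nth.
split.
  apply: covers_mod => [|d dm]; first by lia.
  have [lt|le] := ltnP d M.
    have [d0|d0] := posnP d.
      by apply: (go2 0 0%R) => //; apply: (in_nth 2) => //=; do ?congr (_, _); lia.
    have [lt1|le1] := leqP d t.
      by apply: (go 6 d.-1 2 0%R) => //=; [lia | do ?congr (_, _); lia].
    have [lt2|le2] := leqP d (2 * t).
      by apply: (go 2 (d - t.+1) 2 0%R) => //=; [lia | do ?congr (_, _); lia].
    have [lt3|le3] := leqP d (3 * t).
      by apply: (go 2 (3 * t - d) 1 0%R) => //=; [lia | do ?congr (_, _); lia].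
    have [d3|d3] := eqVneq d (3 * t + 1).
      by apply: (go2 0 0%R) => //; apply: (in_nth 1) => //=; do ?congr (_, _); lia.
    have [lt4|le4] := leqP d (4 * t + 1).
      by apply: (go 5 (d - (3 * t + 2)) 1 1%R) => //=; [lia | do ?congr (_, _); lia].
    have [lt5|le5] := leqP d (5 * t + 1).
      by apply: (go 4 (5 * t + 1 - d) 2 0%R) => //=; [lia | do ?congr (_, _); lia].
    by apply: (go 6 (6 * t + 1 - d) 1 0%R) => //=; [lia | do ?congr (_, _); lia].
  have [d0|d0] := eqVneq d M.
    by apply: (go2 1 0%R) => //; apply: (in_nth 0) => //=; do ?congr (_, _); lia.
  have [lt1|le1] := leqP d (M + t).
    by apply: (go 7 (d - M).-1 0 0%R) => //=; [lia | do ?congr (_, _); lia].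
  have [lt2|le2] := leqP d (M + 2 * t).
    by apply: (go 3 (d - M - t.+1) 0 0%R) => //=; [lia | do ?congr (_, _); lia].
  have [lt3|le3] := leqP d (M + 3 * t).
    by apply: (go 3 (M + 3 * t - d) 1 0%R) => //=; [lia | do ?congr (_, _); lia].
  have [d3|d3] := eqVneq d (M + 3 * t + 1).
    by apply: (go2 1 0%R) => //; apply: (in_nth 1) => //=; do ?congr (_, _); lia.
  have [lt4|le4] := leqP d (M + 4 * t + 1).
    by apply: (go 4 (d - M - (3 * t + 2)) 1 0%R) => //=; [lia | do ?congr (_, _); lia].
  have [lt5|le5] := leqP d (M + 5 * t + 1).
    by apply: (go 5 (M + 5 * t + 1 - d) 0 0%R) => //=; [lia | do ?congr (_, _); lia].
  by apply: (go 7 (M + 6 * t + 1 - d) 1 0%R) => //=; [lia | do ?congr (_, _); lia].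
suff half e d : e < 2 -> 0 < d < M -> covers m (B1 ++ B2) e e (Posz d).
  move=> e d e2 dm dM; have [lt|le] := ltnP d M; first by apply: half; lia.
  apply: covers_sym; have e2' : 0 < m - d < M by lia.
  have [b bB [k kin]] := half e _ e2 e2'; exists b => //; exists (k + 1)%R.
  by have -> : (- Posz d + (k + 1) * m%:Z = Posz (m - d) + k * m%:Z)%R by lia.
case: e => [|[|e]] // _ dM.
- have [lt1|le1] := leqP d (2 * t).
    case: (boolP (odd d)) => od.
      by apply: (go 2 (t - (d.+1)./2) 0 0%R) => //=; [lia | do ?congr (_, _); lia].
    by apply: (go 0 (d./2.-1) 0 0%R) => //=; [lia | do ?congr (_, _); lia].
  have [lt2|le2] := leqP d (3 * t).
    by apply: (go 0 (3 * t - d) 2 0%R) => //=; [lia | do ?congr (_, _); lia].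
  have [d3|d3] := eqVneq d (3 * t + 1).
    by apply: (go2 0 0%R) => //; apply: (in_nth 0) => //=; do ?congr (_, _); lia.
  have [lt4|le4] := leqP d (4 * t + 1).
    by apply: (go 0 (d - (3 * t + 2)) 1 0%R) => //=; [lia | do ?congr (_, _); lia].
  case: (boolP (odd d)) => od.
    by apply: (go 4 ((d - 4 * t - 3)./2) 0 0%R) => //=; [lia | do ?congr (_, _); lia].
  by apply: (go 6 ((6 * t - d)./2) 0 0%R) => //=; [lia | do ?congr (_, _); lia].
- have [lt1|le1] := leqP d (2 * t).
    case: (boolP (odd d)) => od.
      by apply: (go 3 (t - (d.+1)./2) 2 0%R) => //=; [lia | do ?congr (_, _); lia].
    by apply: (go 1 (d./2.-1) 0 0%R) => //=; [lia | do ?congr (_, _); lia].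
  have [lt2|le2] := leqP d (3 * t).
    by apply: (go 1 (3 * t - d) 2 0%R) => //=; [lia | do ?congr (_, _); lia].
  have [d3|d3] := eqVneq d (3 * t + 1).
    by apply: (go2 1 0%R) => //; apply: (in_nth 2) => //=; do ?congr (_, _); lia.
  have [lt4|le4] := leqP d (4 * t + 1).
    by apply: (go 1 (d - (3 * t + 2)) 1 0%R) => //=; [lia | do ?congr (_, _); lia].
  case: (boolP (odd d)) => od.
    by apply: (go 5 ((d - 4 * t - 3)./2) 2 0%R) => //=; [lia | do ?congr (_, _); lia].
  by apply: (go 7 ((6 * t - d)./2) 2 0%R) => //=; [lia | do ?congr (_, _); lia].
Qed.

(** With m = 12t + 4, the 4h(h - 1)m differences between pairs of rows and the h(4m - 4) inside them
    add up to the stated bound. *)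
Lemma OOC_blocks t h : h %% 3 = 0 \/ h %% 3 = 1 -> exists2 B : seq (block nat),
  6 * size B <= 2 * h * (2 * h * (12 * t + 4) - 2) &
  forall p q d, p < 2 * h -> q < 2 * h -> d < 12 * t + 4 ->
    ~~ [&& p == q & (d == 0) || (d == 6 * t + 2)] -> covers (12 * t + 4) B p q (Posz d).
Proof.
move=> h3; have [||B1] := @decomposes_pairs (6 * t + 2) h _ _ h3; [lia|lia|].
have -> : 2 * (6 * t + 2) = 12 * t + 4 by lia.
move=> sB1 cB1; have [B2 sB2 [cB2 cB2']] := two_row_blocks t.
pose f1 (_ : unit) (xe : nat * nat) := 2 * xe.1 + xe.2.
pose f2 x e := 2 * x + e.
exists ([seq block_map (f1 i) b | i <- [:: tt], b <- B1] ++
        [seq block_map (f2 i) b | i <- iota 0 h, b <- B2]).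
  rewrite size_cat !size_allpairs size_iota /= mul1n.
  have := leq_mul (leqnn h) sB2; move: sB1.
  by case: h {h3 cB1} => [|h] /=; lia.
move=> p q d ph qh dm npq.
have f1E Z : f1 tt (Z./2, nat_of_bool (odd Z)) = Z by rewrite /f1 /=; lia.
have f2E Z x : x = Z./2 -> f2 x (nat_of_bool (odd Z)) = Z by rewrite /f2 /=; lia.
have [pq|pq] := eqVneq p./2 q./2; last first.
  apply: (@covers_mem _ _ [seq block_map (f1 i) b | i <- [:: tt], b <- B1]).
    by move=> b bB; rewrite mem_cat bB.
  by rewrite -(f1E p) -(f1E q); apply: covers_family => //; apply: cB1; lia.
apply: (@covers_mem _ _ [seq block_map (f2 i) b | i <- iota 0 h, b <- B2]).
  by move=> b bB; rewrite mem_cat bB orbT.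
rewrite -(f2E p p./2) // -(f2E q p./2) //; apply: covers_family.
  by rewrite mem_iota; lia.
have [e|e] := eqVneq p q.
  by rewrite -e; apply: cB2'; lia.
case: (boolP (odd p)) => op.
  by have -> : odd q = false; [lia | apply: covers_sym; apply: cB2].
by have -> : odd q = true; [lia | apply: cB2].
Qed.

(** * Residues modulo m, and correlations as cardinals *)

Lemma eqmodzP (m : nat) (x y : int) :
  (x = y %[mod m])%Z <-> exists k : int, (x = y + k * m%:Z)%R.
Proof.
split=> [e|[k ->]]; last by rewrite addrC modzMDl.
exists ((x %/ m)%Z - (y %/ m)%Z)%R.
move: (divz_eq x m) (divz_eq y m); rewrite e.
by move: (x %/ m)%Z (y %/ m)%Z (y %% m)%Z => a b c; lia.
Qed.

Lemma cshift_mod m r (j : 'I_m) : (Posz (cshift r j) = j%:Z + r %[mod m])%Z.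
Proof.
have m_gt0 : 0 < m by apply: leq_ltn_trans (ltn_ord j).
by rewrite /= gez0_abs ?modz_mod // modz_ge0 //; lia.
Qed.

Lemma ord_mod_inj m (i j : 'I_m) : (Posz i = Posz j %[mod m])%Z -> i = j.
Proof.
by rewrite !modz_small ?ltz_nat ?ltn_ord //= => -[/val_inj].
Qed.

Lemma correlationE n m (A B : 'M[bool]_(n, m)) r :
  correlation A B r =
  #|[set P : 'I_n * 'I_m | A P.1 P.2 && B P.1 (cshift r P.2)]|.
Proof.
rewrite /correlation pair_big /= -sum1_card [RHS]big_mkcond.
by apply: eq_bigr => P _; rewrite inE mulnb; case: (_ && _).
Qed.

Lemma hamming_weightE n m (A : 'M[bool]_(n, m)) :
  hamming_weight A = #|[set P : 'I_n * 'I_m | A P.1 P.2]|.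
Proof.
rewrite /hamming_weight pair_big /= -sum1_card [RHS]big_mkcond.
by apply: eq_bigr => P _; rewrite inE; case: (A _ _).
Qed.

(** * The Johnson bound *)

Section UpperBound.
Variables (n m : nat) (C : {set 'M[bool]_(n, m)}).
Hypothesis (m_gt0 : 0 < m) (C_OOC : is_OOC 3 1 C).

(* Shift every codeword meeting row [i] so that one of its points is [(i, 0)]:
   the remaining points are pairwise distinct and avoid [(i, 0)]. *)
Lemma row_degree_bound (i : 'I_n) :
  2 * \sum_(A in C) \sum_(j < m) A i j <= n * m - 1.
Proof.
have [wtC autoC crossC] := C_OOC.
pose X := [set z : 'M[bool]_(n, m) * 'I_m * ('I_n * 'I_m) |
  [&& z.1.1 \in C, z.1.1 i z.1.2, z.2 != (i, z.1.2) & z.1.1 z.2.1 z.2.2]].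
(* By weight 3, each point of row [i] has two companions in its codeword. *)
have -> : 2 * \sum_(A in C) \sum_(j < m) A i j = #|X|.
  transitivity (\sum_(z : 'M[bool]_(n, m) * 'I_m | (z.1 \in C) && z.1 i z.2) 2).
    rewrite big_distrr /= [RHS](eq_bigl (fun z => (z.1 \in C) && (true && z.1 i z.2))) //.
    rewrite -(pair_big_dep (mem C) (fun A j => true && A i j) (fun _ _ => 2)) /=.
    apply: eq_bigr => A _; rewrite big_distrr /= [RHS]big_mkcond.
    by apply: eq_bigr => j _; case: (A i j).
  rewrite -sum1_card.
  rewrite (eq_bigl (fun z : 'M[bool]_(n, m) * 'I_m * ('I_n * 'I_m) => ((z.1.1 \in C) && z.1.1 i z.1.2)
     && ((z.2 != (i, z.1.2)) && z.1.1 z.2.1 z.2.2))); last first.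
    by move=> z; rewrite inE andbA.
  rewrite -(pair_big_dep (fun z : 'M[bool]_(n, m) * 'I_m => (z.1 \in C) && z.1 i z.2)
     (fun z P => (P != (i, z.2)) && z.1 P.1 P.2) (fun _ _ => 1)) /=.
  apply: eq_bigr => -[A j] /= /andP[AC Aij].
  have := wtC A AC; rewrite hamming_weightE (cardsD1 (i, j)) inE Aij /= => -[<-].
  by rewrite -sum1_card; apply: eq_bigl => P; rewrite !inE.
pose o : 'I_m := Ordinal m_gt0.
pose phi (z : 'M[bool]_(n, m) * 'I_m * ('I_n * 'I_m)) := (z.2.1, cshift (- (Posz z.1.2))%R z.2.2).
have phi_inj : {in X &, injective phi}.
  move=> [[A j] [p x]] [[B k] [q y]]; rewrite !inE /= => /and4P[AC Aij Pn Apx] /and4P[BC Bik Qn Bqy].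
  move=> e_phi; have /= epq := congr1 fst e_phi; subst q.
  have /eqmodzP[c1 E1] := cshift_mod (- Posz j)%R x.
  have /eqmodzP[c2 E2] := cshift_mod (- Posz k)%R y.
  have exy' : Posz (cshift (- (Posz j))%R x) = Posz (cshift (- (Posz k))%R y).
    exact (congr1 (fun z : 'I_n * 'I_m => Posz z.2) e_phi).
  (* The shift by k - j carries both (i, j) and (p, x) to points of [B], so the correlation exceeds
     1; this is possible only for A = B and r = 0 modulo m. *)
  pose r : int := (Posz k - Posz j)%R.
  have rj : cshift r j = k.
    by apply: ord_mod_inj; rewrite cshift_mod; congr (modz _ _); rewrite /r; lia.
  have rx : cshift r x = y.
    apply: ord_mod_inj; rewrite cshift_mod; apply/eqmodzP; exists (c2 - c1)%R.
    by move: exy'; rewrite E1 E2 /r; lia.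
  have cor : 1 < correlation A B r.
    rewrite correlationE; apply/card_gt1P; exists (i, j), (p, x).
    by rewrite !inE /= Aij rj Bik Apx rx Bqy eq_sym.
  have [eAB|/eqP nAB] := eqVneq A B; last by have := crossC A B r AC BC nAB; lia.
  subst B; have [r0|rn0] := eqVneq (r %% m)%Z (0 %% m)%Z.
    have ekj : k = j.
      apply: ord_mod_inj; have /eqmodzP[c E] := r0; apply/eqmodzP; exists c.
      by move: E; rewrite /r; lia.
    rewrite ekj; congr (_, _, (_, _)); apply: ord_mod_inj.
    apply/eqmodzP; exists (c2 - c1)%R.
    by move: exy'; rewrite E1 E2 ekj; lia.
  by have := autoC A r AC rn0; lia.
rewrite -(card_in_imset phi_inj).
have : phi @: X \subset [set~ (i, o)].
  apply/subsetP=> _ /imsetP[[[A j] [p x]] + ->]; rewrite !inE /= => /and4P[_ _ Pn _].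
  apply: contraNN Pn => /eqP e_phi; have /= -> := congr1 fst e_phi.
  apply/eqP; congr pair; apply: ord_mod_inj.
  have /eqmodzP[c E] := cshift_mod (- Posz j)%R x.
  have E0 : Posz (cshift (- Posz j)%R x) = 0%R.
    exact (congr1 (fun z : 'I_n * 'I_m => Posz z.2) e_phi).
  by apply/eqmodzP; exists (- c)%R; move: E; rewrite E0; lia.
by move/subset_leq_card; rewrite cardsC1 card_prod !card_ord; lia.
Qed.

(** Counting ones by rows: there are 3 #|C| of them, and by [row_degree_bound] each row holds at
    most the inner floor. *)
Lemma OOC31_johnson : #|C| <= johnson_bound n m 3 1.
Proof.
rewrite johnson_bound31 leq_divRL // mulnC.
have [wtC _ _] := C_OOC.
have -> : 3 * #|C| = \sum_(i < n) \sum_(A in C) \sum_(j < m) A i j.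
  rewrite exchange_big /= mulnC -sum_nat_const; apply: eq_bigr => A AC.
  by rewrite -(wtC A AC).
rewrite -[X in X * _]card_ord -sum_nat_const; apply: leq_sum => i _.
by rewrite leq_divRL // mulnC row_degree_bound.
Qed.

End UpperBound.

(** * From a covering list of blocks to a code *)

Lemma uniq_map_inj (T U : eqType) (f : T -> U) s :
  uniq (map f s) -> {in s &, injective f}.
Proof.
elim: s => [|x s IH] //= /andP[fx us] a b; rewrite !inE.
move=> /predU1P[->|aS] /predU1P[->|bS] // e; last exact: IH.
  by rewrite e map_f in fx.
by rewrite -e map_f in fx.
Qed.

Definition block_point (V : Type) (b : block V) (k : nat) : V * int :=
  nth b.1.1 [:: b.1.1; b.1.2; b.2] k.

(* The position in [block_diffs] of the difference from point [k] to point [l]. *)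
Definition diff_index (k l : nat) : nat :=
  nth 0 (nth [::] [:: [:: 0; 0; 1]; [:: 3; 0; 2]; [:: 4; 5; 0]] k) l.

Lemma nth_block_diffs (V : Type) x0 (b : block V) k l : k < 3 -> l < 3 -> k != l ->
  nth x0 (block_diffs b) (diff_index k l) =
  ((block_point b k).1, (block_point b l).1, ((block_point b l).2 - (block_point b k).2)%R).
Proof.
by case: b => [[[? ?] [? ?]] [? ?]]; move: k l => [|[|[|k]]] [|[|[|l]]].
Qed.

Lemma diff_index_inj k l k' l' : k < 3 -> l < 3 -> k' < 3 -> l' < 3 ->
  k != l -> k' != l' -> diff_index k l = diff_index k' l' -> k = k'.
Proof. by move: k l k' l' => [|[|[|k]]] [|[|[|l]]] [|[|[|k']]] [|[|[|l']]]. Qed.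

Definition block_mx n m (b : block nat) : 'M[bool]_(n, m) :=
  \matrix_(i, j) has (fun k => ((block_point b k).1 == i :> nat)
                      && ((block_point b k).2 == Posz j %[mod m])%Z) (iota 0 3).

Lemma block_mxP n m (b : block nat) (i : 'I_n) (j : 'I_m) :
  reflect (exists k, [/\ k < 3, (block_point b k).1 = i & ((block_point b k).2 = Posz j %[mod m])%Z])
          (block_mx n m b i j).
Proof.
rewrite mxE; apply: (iffP hasP) => [[k]|[k [k3 e1 e2]]].
  by rewrite mem_iota => /= k3 /andP[/eqP e1 /eqP e2]; exists k.
by exists k; rewrite ?mem_iota // e1 e2 !eqxx.
Qed.

Section BlocksToCode.
Variables (n m M : nat) (B : seq (block nat)).
Hypotheses (n_gt0 : 0 < n) (M_gt0 : 0 < M < m).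
Hypothesis uB : uniq B.
Hypothesis sizeB : 6 * size B <= n * (n * m - 2).
Hypothesis coverB : forall p q d, p < n -> q < n -> d < m ->
  ~~ [&& p == q & (d == 0) || (d == M)] -> covers m B p q (Posz d).

Let slot (z : block nat * nat) : nat * nat * nat :=
  let: (p, q, d) := nth (0, 0, 0%R) (block_diffs z.1) z.2 in (p, q, `|(d %% m)%Z|%N).
Let slots := [seq (b, s) | b <- B, s <- iota 0 6].

Let m_gt0 : 0 < m. Proof. by lia. Qed.

Let M' : 'I_m := Ordinal (proj2 (andP M_gt0)).
Let o : 'I_m := Ordinal m_gt0.

Let needed : {set 'I_n * 'I_n * 'I_m} :=
  [set z | ~~ [&& z.1.1 == z.1.2 & (z.2 == o) || (z.2 == M')]].
Let tonat (z : 'I_n * 'I_n * 'I_m) : nat * nat * nat := (nat_of_ord z.1.1, nat_of_ord z.1.2, nat_of_ord z.2).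

(** At most two differences are excluded for each row paired with itself. *)
Let card_needed : n * (n * m - 2) <= #|needed|.
Proof.
have := cardsC needed; rewrite !card_prod !card_ord.
have : ~: needed \subset [set (i.1, i.1, if i.2 then o else M') | i in {: 'I_n * bool}].
  apply/subsetP=> -[[p q] d]; rewrite !inE negbK /= => /andP[/eqP-> /orP[]] /eqP->; apply/imsetP.
    by exists (q, true).
  by exists (q, false).
move/subset_leq_card/leq_trans/(_ (leq_imset_card _ _)).
by rewrite card_prod card_ord card_bool; nia.
Qed.

(* Every needed difference is covered and there are as many slots as needed
   differences, so each one is covered exactly once. *)
Let slots_spec : [/\ uniq (map slot slots), size B * 6 = n * (n * m - 2)
  & map slot slots =i map tonat (enum needed)].
Proof.
have tonat_inj : injective tonat.
  by move=> [[p q] d] [[p' q'] d'] [/val_inj-> /val_inj-> /val_inj->].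
have uS : uniq (map tonat (enum needed)) by rewrite map_inj_uniq ?enum_uniq.
have sub : {subset map tonat (enum needed) <= map slot slots}.
  move=> _ /mapP[[[p q] d] + ->]; rewrite mem_enum inE /= => Hneed.
  have [||||b bB [k kin]] := coverB (p := p) (q := q) (d := d) => //.
  apply/mapP; exists (b, index (nat_of_ord p, nat_of_ord q, (Posz d + k * m%:Z)%R) (block_diffs b)).
    apply/allpairsP; eexists (b, _); split; [exact: bB| |reflexivity].
    rewrite mem_iota /= add0n; move: kin; rewrite -index_mem.
    by case: (b) => [[[? ?] [? ?]] [? ?]].
  rewrite /slot nth_index // /tonat /=; congr (_, _, _).
  by rewrite addrC modzMDl modz_small ?ltz_nat ?ltn_ord.
have sS : size (map slot slots) = size B * 6 by rewrite size_map size_allpairs size_iota.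
have le : size (map slot slots) <= size (map tonat (enum needed)).
  by rewrite sS size_map -cardE; apply: leq_trans card_needed; lia.
have [e1 e2] := uniq_min_size uS sub le.
split; first exact: leq_size_uniq le.
  apply/eqP; rewrite eqn_leq -{2}sS -e1 size_map -cardE card_needed andbT; lia.
by move=> z; rewrite e2.
Qed.

Let slot_diff b k l : k < 3 -> l < 3 -> k != l -> slot (b, diff_index k l) =
  ((block_point b k).1, (block_point b l).1,
   `|(((block_point b l).2 - (block_point b k).2) %% m)%Z|%N).
Proof. by move=> k3 l3 kl; rewrite /slot nth_block_diffs. Qed.

Let diff_index_lt k l : k < 3 -> l < 3 -> diff_index k l < 6.
Proof. by move: k l => [|[|[|k]]] [|[|[|l]]]. Qed.

(** As no slot is spare, every difference of a block is a needed one. Hence its rows are below [n],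
    and two of its points cannot coincide modulo [m], which would give the difference 0 within a
    row. *)
Let block_spec b k l : b \in B -> k < 3 -> l < 3 -> k != l ->
  (block_point b k).1 < n /\
  ~ ((block_point b k).1 = (block_point b l).1 /\ ((block_point b k).2 = (block_point b l).2 %[mod m])%Z).
Proof.
move=> bB k3 l3 kl; have [_ _ eS] := slots_spec.
have : slot (b, diff_index k l) \in map tonat (enum needed).
  by rewrite -eS map_f // allpairs_f // mem_iota diff_index_lt.
rewrite slot_diff // => /mapP[[[p q] d]]; rewrite mem_enum inE /= => Hneed [-> -> ed].
split=> // -[/val_inj epq /eqmodzP[c E]]; case/negP: Hneed; rewrite epq eqxx /=; apply/orP; left.
apply/eqP/val_inj => /=; rewrite -ed E.
by have -> : ((block_point b l).2 - ((block_point b l).2 + c * m) = - c * m)%R by [lia]; rewrite modzMl.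
Qed.

(** Two points common to both blocks after a shift have the same difference in each, so they occupy
    equal slots; uniqueness of slots gives the same block and the same position in it. *)
Let shift_unique b b' (P Q : 'I_n * 'I_m) r : b \in B -> b' \in B -> P != Q ->
  block_mx n m b P.1 P.2 -> block_mx n m b Q.1 Q.2 ->
  block_mx n m b' P.1 (cshift r P.2) -> block_mx n m b' Q.1 (cshift r Q.2) ->
  b = b' /\ (r = 0 %[mod m])%Z.
Proof.
move=> bB bB' PQ /block_mxP[k [k3 Pk1 /eqmodzP[c1 Pk2]]] /block_mxP[l [l3 Ql1 /eqmodzP[c2 Ql2]]].
move=> /block_mxP[k' [k3' Pk1' Pk2']] /block_mxP[l' [l3' Ql1' Ql2']].
have /eqmodzP[c3 E3] : ((block_point b' k').2 = Posz P.2 + r %[mod m])%Z by rewrite Pk2' cshift_mod.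
have /eqmodzP[c4 E4] : ((block_point b' l').2 = Posz Q.2 + r %[mod m])%Z by rewrite Ql2' cshift_mod.
have PQne : P.1 = Q.1 -> (Posz P.2 = Posz Q.2 %[mod m])%Z -> False.
  move=> e1 /ord_mod_inj e2; case/eqP: PQ; move: e1 e2.
  by case: (P) (Q) => [? ?] [? ?] /= -> ->.
have kl : k != l.
  apply/eqP=> e; subst l; apply: PQne; first by apply: val_inj; rewrite /= -Pk1 -Ql1.
  by apply/eqmodzP; exists (c2 - c1)%R; move: Ql2; rewrite Pk2; lia.
have kl' : k' != l'.
  apply/eqP=> e; subst l'; apply: PQne; first by apply: val_inj; rewrite /= -Pk1' -Ql1'.
  by apply/eqmodzP; exists (c4 - c3)%R; move: E4; rewrite E3; lia.
have [uS _ _] := slots_spec.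
have [eb ei] : (b, diff_index k l) = (b', diff_index k' l').
  apply: (uniq_map_inj uS); rewrite ?allpairs_f ?mem_iota ?diff_index_lt //.
  rewrite !slot_diff // Pk1 Ql1 Pk1' Ql1'; congr (_, _, absz _); apply/eqmodzP.
  by exists (c2 - c1 - c4 + c3)%R; rewrite Pk2 Ql2 E3 E4; lia.
(* Equal positions name the same point of the block, and a point carried to itself forces r = 0
   modulo m. *)
split=> //; have ek := diff_index_inj k3 l3 k3' l3' kl kl' ei.
apply/eqmodzP; exists (c1 - c3)%R; move: E3; rewrite -ek -eb Pk2; clear; lia.
Qed.

Lemma blocks_to_OOC : exists2 C : {set 'M[bool]_(n, m)},
  is_OOC 3 1 C & #|C| * 6 = n * (n * m - 2).
Proof.
have mB_weight b : b \in B -> #|[set P : 'I_n * 'I_m | block_mx n m b P.1 P.2]| = 3.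
  move=> bB.
  have rown (k : 'I_3) : (block_point b k).1 < n.
    (* [block_spec] speaks of two distinct points; [l] is any other index. *)
    case: k => k k3; pose l := if k == 0 then 1 else 0.
    by have [] // := @block_spec b k l bB k3; rewrite /l; case: k {k3 l} => [|k].
  have posm (k : 'I_3) : `|((block_point b k).2 %% m)%Z|%N < m.
    by rewrite -ltz_nat gez0_abs ?modz_ge0 ?ltz_pmod ?gt_eqF ?ltz_nat.
  pose f (k : 'I_3) : 'I_n * 'I_m := (Ordinal (rown k), Ordinal (posm k)).
  have absE (k : 'I_3) : (Posz `|((block_point b k).2 %% m)%Z|%N = (block_point b k).2 %[mod m])%Z.
    by rewrite gez0_abs ?modz_mod // modz_ge0 //; lia.
  have f_inj : injective f.
    move=> k l [e1 e2]; apply/eqP/negPn/negP => kl.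
    have [_ []] := block_spec bB (ltn_ord k) (ltn_ord l) kl.
    by split=> //; rewrite -absE e2 absE.
  have -> : [set P : 'I_n * 'I_m | block_mx n m b P.1 P.2] = f @: setT.
    apply/setP=> -[i j]; rewrite inE /=; apply/block_mxP/imsetP => [[k [k3 e1 e2]]|[k _ [-> ->]]].
      exists (Ordinal k3) => //; congr pair; first exact: val_inj.
      by apply: ord_mod_inj; rewrite absE e2.
    by exists k; split=> //=; rewrite absE.
  by rewrite card_imset // cardsT card_ord.
(* Equal matrices share two points under the shift by 0. *)
have mB_inj : {in B &, injective (block_mx n m)}.
  move=> b b' bB bB' e.
  have : 1 < #|[set P : 'I_n * 'I_m | block_mx n m b P.1 P.2]| by rewrite mB_weight.
  case/card_gt1P=> P [Q []]; rewrite !inE => bP bQ PQ.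
  have c0 (j : 'I_m) : cshift 0 j = j by apply: ord_mod_inj; rewrite cshift_mod addr0.
  by have [] // := @shift_unique b b' P Q 0%R bB bB' PQ bP bQ; rewrite -e !c0.
pose C := [set A in map (block_mx n m) B].
have CP A : A \in C -> exists2 b, b \in B & A = block_mx n m b by rewrite inE => /mapP.
have corP b b' r : b \in B -> b' \in B ->
    1 < correlation (block_mx n m b) (block_mx n m b') r -> b = b' /\ (r = 0 %[mod m])%Z.
  move=> bB bB'; rewrite correlationE => /card_gt1P[P [Q []]].
  by rewrite !inE => /andP[h1 h2] /andP[h3 h4] PQ; apply: (shift_unique bB bB' PQ).
exists C; last first.
  have [_ <- _] := slots_spec; congr (_ * _).
  rewrite cardsE -[RHS](size_map (block_mx n m)); apply/card_uniqP.
  by rewrite map_inj_in_uniq.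
split.
- by move=> A /CP[b bB ->]; rewrite hamming_weightE mB_weight.
- move=> A r /CP[b bB ->] r0; rewrite leqNgt; apply/negP => /(corP _ _ _ bB bB)[_ r0'].
  by rewrite r0' eqxx in r0.
- move=> A A' r /CP[b bB ->] /CP[b' bB' ->] nAA'; rewrite leqNgt; apply/negP.
  by move=> /(corP _ _ _ bB bB')[e _]; apply: nAA'; rewrite e.
Qed.

End BlocksToCode.

Theorem theorem5p7 (n m : nat) (n_gt0 : 0 < n) (m_gt0 : 0 < m)
    (n_mod6 : n = 0 %[mod 6] \/ n = 2 %[mod 6]) (m_mod12 : m = 4 %[mod 12]) :
  exists C : {set 'M[bool]_(n, m)},
    [/\ is_OOC 3 1 C, #|C| = johnson_bound n m 3 1 & optimal_OOC 3 1 C].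
Proof.
have [t em] : exists t, m = 12 * t + 4 by exists (m %/ 12); lia.
have [h en] : exists h, n = 2 * h by exists (n %/ 2); lia.
have h3 : h %% 3 = 0 \/ h %% 3 = 1 by lia.
have [B sB cB] := OOC_blocks t h3.
(* Removing repetitions keeps the covering and cannot raise the size. *)
have [||||C OOC_C cardC] := @blocks_to_OOC n m (6 * t + 2) (undup B) n_gt0.
- by lia.
- exact: undup_uniq.
- by rewrite em en; apply: leq_trans sB; rewrite leq_mul2l size_undup.
- move=> p q d; rewrite em en => pn qn dm npq.
  by apply: covers_mem (cB _ _ _ pn qn dm npq) => b; rewrite mem_undup.
have J : #|C| = johnson_bound n m 3 1.
  (* As nm is even, the inner floor is hm - 1; from 6c = 2n(hm - 1) the outer division by 3 is
     exact. *)
  rewrite johnson_bound31; move: #|C| cardC => c.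
  have -> : (n * m - 1) %/ 2 = h * m - 1 by rewrite en -mulnA; lia.
  have -> : n * m - 2 = 2 * (h * m - 1) by rewrite en -mulnA; lia.
  move=> e; have <- : c * 3 = n * (h * m - 1) by lia.
  by rewrite mulnK.
exists C; split=> //; split=> // C' OOC_C'.
by rewrite J; apply: OOC31_johnson.
Qed.
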